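(* Let $N\ge1$, let $p$ be a prime with $p\mid N$, and let $r,s$ be positive integers. Then for every $f\in\mathcal{M}(N)$, $$f|\mathcal{T}(p^{r})\mathcal{T}(p^{s})=f|\mathcal{T}(p^{s})\mathcal{T}(p^{r})=f|\mathcal{T}(p^{r+s}).$$
   Context: Let $q=e^{2\pi i\tau}$. $\mathcal{M}(N)$ denotes the multiplicative group of meromorphic modular forms $f$ on the upper half-plane of some integer weight $k$ for $\Gamma_0(N)$ with some unitary multiplier system (i.e. $f(\gamma\tau)=\chi(\gamma)(c\tau+d)^kf(\tau)$ for $\gamma\in\Gamma_0(N)$, $\chi:\Gamma_0(N)\to S^1$, meromorphic at cusps), with integer Fourier coefficients at $i\infty$ and leading coefficient $1$. With $(f|_k\gamma)(\tau)=\det(\gamma)^{k/2}(c\tau+d)^{-k}f(\gamma\tau)$, for a prime $p\mid N$, $r\ge1$ and $f\in\mathcal{M}(N)$ of weight $k$: $f|\mathcal{T}(p^{r}):=\varepsilon\, p^{\frac{rkp^{r}}{2}}\prod_{j=0}^{p^{r}-1}f|_{k}\begin{psmallmatrix}1&j\\0&p^{r}\end{psmallmatrix}$, with $\varepsilon$ the constant making the leading coefficient 1; it lies in $\mathcal{M}(N)$ with weight $kp^r$. $f|\mathcal{T}(a)\mathcal{T}(b)$ means $(f|\mathcal{T}(a))|\mathcal{T}(b)$, each operator using the weight of its argument. *)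

(* Defs.v *)
From Stdlib Require Import Reals ZArith Znumtheory List.
From Coquelicot Require Import Coquelicot.

Open Scope R_scope.

Definition upper (z : C) : Prop := 0 < Im z.

(* A meromorphic function is represented by a total function C -> C whose
   values at a discrete set of points (in particular at its poles) carry no
   information: every statement about its values is made on punctured
   neighbourhoods. *)
Definition mero_eq (U : C -> Prop) (f g : C -> C) : Prop :=
  forall z, U z -> locally' z (fun w => f w = g w).

Definition holomorphic_at (g : C -> C) (z : C) : Prop :=
  locally z (fun w => ex_derive (K := C_AbsRing) (V := C_NormedModule) g w).

Definition meromorphic_on (U : C -> Prop) (f : C -> C) : Prop :=
  forall z, U z -> exists (n : nat) (g : C -> C),
    holomorphic_at g z /\
    locally' z (fun w => f w = (g w / (w - z) ^ n)%C).

Definition Cpowz (z : C) (k : Z) : C :=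
  match k with
  | Z0 => RtoC 1
  | Zpos n => (z ^ Pos.to_nat n)%C
  | Zneg n => (/ (z ^ Pos.to_nat n))%C
  end.

Definition Cprod (m : nat) (F : nat -> C) : C :=
  fold_right (fun j acc => (F j * acc)%C) (RtoC 1) (seq 0 m).

(* exp (2 pi i z) *)
Definition cis2pi (z : C) : C :=
  (exp (- (2 * PI * Im z)) * cos (2 * PI * Re z),
   exp (- (2 * PI * Im z)) * sin (2 * PI * Re z)).

Record mat2 : Type := Mat2 { ma : Z; mb : Z; mc : Z; md : Z }.

Definition mdet (g : mat2) : Z := (ma g * md g - mb g * mc g)%Z.

Definition in_SL2Z (g : mat2) : Prop := mdet g = 1%Z.

Definition in_Gamma0 (N : nat) (g : mat2) : Prop :=
  in_SL2Z g /\ (Z.of_nat N | mc g)%Z.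

Definition autfactor (g : mat2) (t : C) : C :=
  (RtoC (IZR (mc g)) * t + RtoC (IZR (md g)))%C.

Definition mobius (g : mat2) (t : C) : C :=
  ((RtoC (IZR (ma g)) * t + RtoC (IZR (mb g))) / autfactor g t)%C.

Definition slash (k : Z) (g : mat2) (f : C -> C) (t : C) : C :=
  (RtoC (Rpower (IZR (mdet g)) (IZR k / 2)) *
   Cpowz (autfactor g t) (- k) * f (mobius g t))%C.

(* f(t) = sum_(n >= 0) a_n exp (2 pi i (kappa + n) t / h) for Im t large.
   The real number kappa accounts both for finitely many negative exponents
   and for the fractional exponents produced by a unitary multiplier of
   t |-> t + h. *)
Definition q_expansion (h kappa : R) (a : nat -> C) (f : C -> C) : Prop :=
  exists Y : R, forall z : C, Y < Im z ->
    locally' z (fun t =>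
      is_series (K := C_AbsRing) (V := C_NormedModule)
        (fun n => (a n * cis2pi (RtoC ((kappa + INR n) / h) * t))%C) (f t)).

(* The least h >= 1 such that g [1, h; 0, 1] g^-1, whose lower left entry is
   - c^2 h, belongs to Gamma_0(N). *)
Definition cusp_width (N : nat) (g : mat2) : Z :=
  (Z.of_nat N / Z.gcd (Z.of_nat N) (mc g * mc g))%Z.

(* The operators T(p^r) depend on the weight of their argument, so a function
   is bundled with its weight. *)
Record wfun : Type := WFun { wt : Z; fn : C -> C }.

Definition wfun_eq (F G : wfun) : Prop :=
  wt F = wt G /\ mero_eq upper (fn F) (fn G).

Definition in_M (N : nat) (F : wfun) : Prop :=
  meromorphic_on upper (fn F) /\
  (exists chi : mat2 -> C, forall g, in_Gamma0 N g ->
     Cmod (chi g) = 1 /\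
     mero_eq upper (fun t => fn F (mobius g t))
       (fun t => (chi g * Cpowz (autfactor g t) (wt F) * fn F t)%C)) /\
  (forall g, in_SL2Z g -> exists (kappa : R) (a : nat -> C),
     q_expansion (IZR (cusp_width N g)) kappa a (slash (wt F) g (fn F))) /\
  (exists (kappa : R) (a : nat -> Z),
     a O = 1%Z /\ q_expansion 1 kappa (fun n => RtoC (IZR (a n))) (fn F)).

Definition leading_coef (f : C -> C) (c : C) : Prop :=
  c <> RtoC 0 /\
  exists (kappa : R) (a : nat -> C), a O = c /\ q_expansion 1 kappa a f.

(* [iota] is Coquelicot's definite description operator. *)
Definition normalizer (g : C -> C) : C :=
  iota (T := C_CompleteNormedModule)
    (fun eps : C => leading_coef (fun t => (eps * g t)%C) (RtoC 1)).

Definition mulT_raw (p r : nat) (F : wfun) (t : C) : C :=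
  (RtoC (Rpower (INR p) (INR r * IZR (wt F) * INR (p ^ r) / 2)) *
   Cprod (p ^ r) (fun j =>
     slash (wt F) (Mat2 1 (Z.of_nat j) 0 (Z.of_nat (p ^ r))) (fn F) t))%C.

(* F | T(p^r) *)
Definition mulT (p r : nat) (F : wfun) : wfun :=
  WFun (wt F * Z.of_nat (p ^ r))
    (fun t => (normalizer (mulT_raw p r F) * mulT_raw p r F t)%C).

(* Main.v *)
Require Import Defs.
From Stdlib Require Import Reals ZArith Znumtheory.
From Coquelicot Require Import Coquelicot.
From Stdlib Require Import Lra Lia List FunctionalExtensionality.

(** Up to a nonzero constant, [f | T(p^r)] is the product of
    [f ((t + j) / P)] over [j < P], where [P = p^r].  Iterating with [P] and
    then [Q] gives the product over [i < Q], [j < P] of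
    [f ((t + i + j Q) / (P Q))], that is, the product attached to [P Q], so only
    the normalizing constants remain to be compared.

    Such a constant is unique: if [c f] has leading coefficient 1 and leading
    exponent [kappa], then [c f(t)] is asymptotic to [exp (2 pi i kappa t)] as
    [Im t] goes to infinity, which determines [kappa] and then [c].

    It exists: with [f = q^kappa A(q)], [x = exp (2 pi i t / P)] and
    [zeta = exp (2 pi i / P)], the product over [j < P] of [A (zeta^j x)] is a
    power series in [x] which is invariant under [x |-> zeta x]; averaging it over
    the powers of [zeta] leaves a power series in [x^P = q], whose constant
    term is [A(0)^P]. *)

(** * Complex series, absolute summability and Cauchy products *)

Local Notation is_Cseries := (is_series (K := C_AbsRing) (V := C_NormedModule)).

Definition abs_summable (u : nat -> C) : Prop := ex_series (fun n => Cmod (u n)).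

Definition Cconv (u v : nat -> C) (n : nat) : C :=
  sum_n (G := C_AbelianMonoid) (fun k => (u k * v (n - k)%nat)%C) n.

Lemma sum_n_Re (u : nat -> C) n :
  Re (sum_n (G := C_AbelianMonoid) u n) = sum_n (fun k => Re (u k)) n.
Proof.
  induction n as [|n IH]; [now rewrite !sum_O|].
  now rewrite !sum_Sn, <- IH.
Qed.

Lemma sum_n_Im (u : nat -> C) n :
  Im (sum_n (G := C_AbelianMonoid) u n) = sum_n (fun k => Im (u k)) n.
Proof.
  induction n as [|n IH]; [now rewrite !sum_O|].
  now rewrite !sum_Sn, <- IH.
Qed.

(** A ball of the product uniform structure on [C] is a square, so closeness of partial sums is
    closeness of both coordinates. *)
Lemma is_Cseries_iff (u : nat -> C) (l : C) :
  is_Cseries u l <->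
  is_series (fun n => Re (u n)) (Re l) /\ is_series (fun n => Im (u n)) (Im l).
Proof.
  split.
  - intros H.
    assert (Hb := proj1 (filterlim_locally (U := C_UniformSpace) _ _) H).
    split; apply (filterlim_locally (U := R_UniformSpace)); intros eps;
      destruct (Hb eps) as [M HM]; exists M; intros n Hn; destruct (HM n Hn) as [H1 H2].
    + rewrite <- sum_n_Re; exact H1.
    + rewrite <- sum_n_Im; exact H2.
  - intros [H1 H2]; apply (filterlim_locally (U := C_UniformSpace)); intros eps.
    destruct (proj1 (filterlim_locally (U := R_UniformSpace) _ _) H1 eps) as [M1 HM1].
    destruct (proj1 (filterlim_locally (U := R_UniformSpace) _ _) H2 eps) as [M2 HM2].
    exists (max M1 M2); intros n Hn; split.
    + specialize (HM1 n ltac:(lia)); rewrite <- sum_n_Re in HM1; exact HM1.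
    + specialize (HM2 n ltac:(lia)); rewrite <- sum_n_Im in HM2; exact HM2.
Qed.

Lemma is_Cseries_unique (u : nat -> C) (l l' : C) : is_Cseries u l -> is_Cseries u l' -> l = l'.
Proof.
  rewrite !is_Cseries_iff; intros [H1 H2] [H3 H4].
  destruct l, l'; f_equal;
    eapply eq_trans; [symmetry; eapply is_series_unique; eassumption
                     |eapply is_series_unique; eassumption|
                      symmetry; eapply is_series_unique; eassumption
                     |eapply is_series_unique; eassumption].
Qed.

Lemma is_Cseries_scal (c : C) (u : nat -> C) (l : C) :
  is_Cseries u l -> is_Cseries (fun n => (c * u n)%C) (c * l)%C.
Proof. exact (is_series_scal_l (K := C_AbsRing) (V := C_NormedModule) c u l). Qed.

Lemma is_Cseries_plus (u v : nat -> C) (lu lv : C) :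
  is_Cseries u lu -> is_Cseries v lv ->
  is_Cseries (fun n => (u n + v n)%C) (lu + lv)%C.
Proof. exact (is_series_plus (K := C_AbsRing) (V := C_NormedModule) u v lu lv). Qed.

Lemma abs_Re_le_Cmod z : Rabs (Re z) <= Cmod z.
Proof.
  eapply Rle_trans; [|apply Rmax_Cmod]; apply Rmax_l.
Qed.

Lemma abs_Im_le_Cmod z : Rabs (Im z) <= Cmod z.
Proof.
  eapply Rle_trans; [|apply Rmax_Cmod]; apply Rmax_r.
Qed.

Lemma abs_summable_Re u : abs_summable u -> ex_series (fun n => Rabs (Re (u n))).
Proof.
  apply (ex_series_le (K := R_AbsRing) (V := R_CompleteNormedModule)); intros n.
  change (Rabs (Rabs (Re (u n))) <= Cmod (u n)); rewrite Rabs_Rabsolu.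
  apply abs_Re_le_Cmod.
Qed.

Lemma abs_summable_Im u : abs_summable u -> ex_series (fun n => Rabs (Im (u n))).
Proof.
  apply (ex_series_le (K := R_AbsRing) (V := R_CompleteNormedModule)); intros n.
  change (Rabs (Rabs (Im (u n))) <= Cmod (u n)); rewrite Rabs_Rabsolu.
  apply abs_Im_le_Cmod.
Qed.

(** A total function of the sequence: the sums attached to all indices [j] can be named at once, and
    equal sequences have equal sums by rewriting. *)
Definition CSeries (u : nat -> C) : C :=
  (Series (fun n => Re (u n)), Series (fun n => Im (u n))).

Lemma CSeries_correct u : abs_summable u -> is_Cseries u (CSeries u).
Proof.
  intros H; apply is_Cseries_iff; split; apply Series_correct, ex_series_Rabs;
    [now apply abs_summable_Re|now apply abs_summable_Im].
Qed.

(** Real and imaginary parts reduce this to four real Cauchy products of absolutely convergent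
    series. *)
Lemma is_Cseries_conv (u v : nat -> C) (lu lv : C) :
  abs_summable u -> abs_summable v -> is_Cseries u lu -> is_Cseries v lv ->
  is_Cseries (Cconv u v) (lu * lv)%C.
Proof.
  intros Au Av; rewrite !is_Cseries_iff; intros [Ru Iu] [Rv Iv].
  pose proof (abs_summable_Re u Au) as ARu; pose proof (abs_summable_Im u Au) as AIu.
  pose proof (abs_summable_Re v Av) as ARv; pose proof (abs_summable_Im v Av) as AIv.
  split.
  - eapply is_series_ext;
      [|exact (is_series_minus _ _ _ _
           (is_series_mult _ _ _ _ Ru Rv ARu ARv) (is_series_mult _ _ _ _ Iu Iv AIu AIv))].
    intros n; unfold Cconv; rewrite sum_n_Re, sum_n_Reals.
    symmetry; apply minus_sum.
  - eapply is_series_ext;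
      [|exact (is_series_plus _ _ _ _
           (is_series_mult _ _ _ _ Ru Iv ARu AIv) (is_series_mult _ _ _ _ Iu Rv AIu ARv))].
    intros n; unfold Cconv; rewrite sum_n_Im, sum_n_Reals.
    symmetry; apply plus_sum.
Qed.

Lemma abs_summable_conv u v :
  abs_summable u -> abs_summable v -> abs_summable (Cconv u v).
Proof.
  intros Au Av.
  destruct Au as [lu Hu]; destruct Av as [lv Hv].
  assert (E : forall w : nat -> C, (fun n => Rabs (Cmod (w n))) = (fun n => Cmod (w n))).
  { intros w; apply functional_extensionality; intros n; apply Rabs_pos_eq, Cmod_ge_0. }
  eapply (ex_series_le (K := R_AbsRing) (V := R_CompleteNormedModule));
    [|eexists; apply (is_series_mult _ _ _ _ Hu Hv)].
  - intros n. change (Rabs (Cmod (Cconv u v n)) <=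
      sum_f_R0 (fun k => Cmod (u k) * Cmod (v (n - k)%nat)) n).
    rewrite Rabs_pos_eq by apply Cmod_ge_0.
    rewrite <- sum_n_Reals; unfold Cconv.
    (* The [n] inside [n - k] is separated from the summation bound, so that the induction runs on
       the bound alone. *)
    generalize n at 1 3; intros m; induction n as [|n IH].
    + rewrite !sum_O, Cmod_mult; apply Rle_refl.
    + rewrite !sum_Sn, <- Cmod_mult.
      eapply Rle_trans; [apply Cmod_triangle|apply Rplus_le_compat_r, IH].
  - rewrite E; eexists; exact Hu.
  - rewrite E; eexists; exact Hv.
Qed.

Lemma Cconv_pow u v (x : C) n :
  Cconv (fun n => (u n * x ^ n)%C) (fun n => (v n * x ^ n)%C) n = (Cconv u v n * x ^ n)%C.
Proof.
  rewrite Cmult_comm; unfold Cconv.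
  etransitivity; [|exact (sum_n_mult_l (K := C_Ring) (x ^ n)%C _ n)].
  apply sum_n_ext_loc; intros k Hk.
  change (u k * x ^ k * (v (n - k)%nat * x ^ (n - k)) = x ^ n * (u k * v (n - k)%nat))%C.
  replace (x ^ n)%C with (x ^ k * x ^ (n - k))%C; [ring|].
  rewrite <- Cpow_add_r; f_equal; lia.
Qed.

(** * Finite products *)

Lemma Cprod_S m F : Cprod (S m) F = (Cprod m F * F m)%C.
Proof.
  unfold Cprod; rewrite seq_S, fold_right_app; simpl.
  generalize (seq 0 m) as s; induction s as [|a s IH]; simpl.
  - ring.
  - rewrite IH; ring.
Qed.

Lemma Cprod_ext m F G : (forall j, (j < m)%nat -> F j = G j) -> Cprod m F = Cprod m G.
Proof.
  induction m as [|m IH]; intros H; [reflexivity|].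
  rewrite !Cprod_S, IH by (intros; apply H; lia); now rewrite H by lia.
Qed.

Lemma Cprod_mult m F G : Cprod m (fun j => (F j * G j)%C) = (Cprod m F * Cprod m G)%C.
Proof.
  induction m as [|m IH]; [unfold Cprod; simpl; ring|].
  rewrite !Cprod_S, IH; ring.
Qed.

Lemma Cprod_const m c : Cprod m (fun _ => c) = (c ^ m)%C.
Proof.
  induction m as [|m IH]; [reflexivity|].
  rewrite Cprod_S, IH, Cpow_S; ring.
Qed.

Lemma Cprod_neq_0 m F : (forall j, F j <> RtoC 0) -> Cprod m F <> RtoC 0.
Proof.
  intros H; induction m as [|m IH].
  - unfold Cprod; simpl; intros E; apply RtoC_inj in E; lra.
  - rewrite Cprod_S; now apply Cmult_neq_0.
Qed.

Lemma Cprod_add m n F :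
  Cprod (m + n) F = (Cprod m F * Cprod n (fun i => F (m + i)%nat))%C.
Proof.
  induction n as [|n IH].
  - rewrite Nat.add_0_r; unfold Cprod at 3; simpl; ring.
  - rewrite Nat.add_succ_r, !Cprod_S, IH; ring.
Qed.

(** Division with remainder by [m]: each index below [n * m] is [i + j * m] for exactly one [i < m]
    and [j < n]. Each induction step appends a block of [m] indices. *)
Lemma Cprod_Cprod m n F :
  Cprod m (fun i => Cprod n (fun j => F (i + j * m)%nat)) = Cprod (n * m) F.
Proof.
  induction n as [|n IH].
  - unfold Cprod at 2 3; simpl. rewrite Cprod_const; apply Cpow_1_l.
  - replace (S n * m)%nat with (n * m + m)%nat by lia.
    rewrite Cprod_add, <- IH, <- Cprod_mult; apply Cprod_ext; intros i _.
    rewrite Cprod_S; do 2 f_equal; lia.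
Qed.

(** A shift by one moves the first factor to the end, where periodicity gives it back. *)
Lemma Cprod_periodic m F k :
  (forall j, F (j + m)%nat = F j) -> Cprod m (fun j => F (j + k)%nat) = Cprod m F.
Proof.
  intros HF; induction k as [|k IH].
  - apply Cprod_ext; intros; f_equal; lia.
  - rewrite <- IH; destruct m as [|m]; [reflexivity|].
    rewrite Cprod_S.
    change (Cprod (S m) (fun j => F (j + k)%nat)) with (Cprod (1 + m) (fun j => F (j + k)%nat)).
    rewrite Cprod_add; unfold Cprod at 2; simpl.
    replace (m + S k)%nat with (k + S m)%nat by lia; rewrite HF.
    rewrite (Cprod_ext m (fun j => F (j + S k)%nat) (fun i => F (S (i + k)))).
    + ring.
    + intros; f_equal; lia.
Qed.

(** * Products of power series, decimation and bounds *)

Lemma is_Cseries_ext (u v : nat -> C) (l : C) :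
  (forall n, u n = v n) -> is_Cseries u l -> is_Cseries v l.
Proof. exact (is_series_ext (K := C_AbsRing) (V := C_NormedModule) u v l). Qed.

Lemma is_series_delta (b : R) : is_series (fun n : nat => match n with O => b | S _ => 0 end) b.
Proof.
  unfold is_series; eapply filterlim_ext; [|apply filterlim_const].
  intros n; induction n as [|n IH]; [now rewrite sum_O|].
  rewrite sum_Sn, <- IH; unfold plus; simpl; ring.
Qed.

Lemma is_Cseries_delta (c : C) :
  is_Cseries (fun n : nat => match n with O => c | S _ => RtoC 0 end) c.
Proof.
  apply is_Cseries_iff; split; (eapply is_series_ext; [|apply is_series_delta]);
    intros [|n]; reflexivity.
Qed.

(** Iterated Cauchy products. The coefficients [c] are chosen before [x], so that one power series
    serves for all rotated arguments [zeta^k x]. *)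
Lemma Cprod_pseries m (u : nat -> nat -> C) :
  exists c : nat -> C, c O = Cprod m (fun j => u j O) /\
    forall x l, (forall j, abs_summable (fun n => (u j n * x ^ n)%C)) ->
      (forall j, is_Cseries (fun n => (u j n * x ^ n)%C) (l j)) ->
      abs_summable (fun n => (c n * x ^ n)%C) /\
      is_Cseries (fun n => (c n * x ^ n)%C) (Cprod m l).
Proof.
  induction m as [|m [c [c0 Hc]]].
  - exists (fun n : nat => match n with O => RtoC 1 | S _ => RtoC 0 end); split; [reflexivity|].
    intros x l _ _; split.
    + exists 1; eapply is_series_ext; [|apply (is_series_delta 1)].
      intros [|n]; simpl; [rewrite Cmult_1_r, Cmod_1|rewrite Cmult_0_l, Cmod_0]; reflexivity.
    + eapply is_Cseries_ext; [|apply (is_Cseries_delta (RtoC 1))].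
      intros [|n]; simpl; ring.
  - exists (Cconv c (u m)); split.
    + rewrite Cprod_S, <- c0; unfold Cconv; now rewrite sum_O.
    + intros x l Hu Hl; destruct (Hc x l Hu Hl) as [A S].
      rewrite Cprod_S; split.
      * eapply ex_series_ext; [|exact (abs_summable_conv _ _ A (Hu m))].
        intros n; simpl; now rewrite Cconv_pow.
      * eapply is_Cseries_ext; [|exact (is_Cseries_conv _ _ _ _ A (Hu m) S (Hl m))].
        intros n; apply Cconv_pow.
Qed.

(** Between consecutive multiples of [P] the partial sums of [v] do not change, so the partial sums
    of the decimated series form a subsequence of those of [v]. *)
Lemma is_Cseries_decimate (P : nat) (v : nat -> C) (l : C) :
  (0 < P)%nat -> (forall n, ~ Nat.divide P n -> v n = RtoC 0) ->
  is_Cseries v l -> is_Cseries (fun n => v (P * n)%nat) l.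
Proof.
  intros HP Hv H.
  assert (H0 : forall N k, (k < P)%nat ->
    sum_n (G := C_AbelianMonoid) v (P * N + k) = sum_n (G := C_AbelianMonoid) v (P * N)).
  { intros N k; induction k as [|k IH]; intros Hk; [f_equal; lia|].
    rewrite Nat.add_succ_r, sum_Sn, IH by lia.
    rewrite Hv; [apply (plus_zero_r (G := C_AbelianGroup))|].
    intros [d Hd]; assert (d <= N \/ N < d)%nat as [|] by lia; nia. }
  apply (filterlim_ext (fun n => sum_n (G := C_AbelianMonoid) v (P * n))).
  - intros n; induction n as [|n IH].
    + now rewrite Nat.mul_0_r, !sum_O, Nat.mul_0_r.
    + rewrite sum_Sn, <- IH.
      replace (P * S n)%nat with (S (P * n + (P - 1))) by lia.
      rewrite sum_Sn, H0 by lia; reflexivity.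
  - eapply filterlim_comp; [|exact H].
    intros Q [M HM]; exists M; intros n Hn; apply HM; nia.
Qed.

Lemma is_Cseries_bounded (u : nat -> C) (l : C) :
  is_Cseries u l -> exists M, forall n, Cmod (u n) <= M.
Proof.
  intros H.
  destruct (filterlim_bounded (K := C_AbsRing) (V := C_NormedModule) _ (ex_intro _ l H))
    as [M HM].
  change (forall n, Cmod (sum_n (G := C_AbelianMonoid) u n) <= M) in HM.
  exists (M + M); intros [|n].
  - specialize (HM O); rewrite sum_O in HM.
    pose proof (Cmod_ge_0 (u O)); lra.
  - pose proof (HM (S n)) as H1; pose proof (HM n) as H2.
    rewrite sum_Sn in H1.
    replace (u (S n)) with
      ((sum_n (G := C_AbelianMonoid) u n + u (S n)) + - sum_n (G := C_AbelianMonoid) u n)%C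
      by ring.
    eapply Rle_trans; [apply Cmod_triangle|]; rewrite Cmod_opp; now apply Rplus_le_compat.
Qed.

Lemma is_Cseries_Cmod_le (u : nat -> C) (l : C) (b : nat -> R) (B : R) :
  is_Cseries u l -> is_series b B -> (forall n, Cmod (u n) <= b n) -> Cmod l <= B.
Proof.
  intros Hu Hb Hle.
  apply (filterlim_le (F := eventually) (fun n => Cmod (sum_n (G := C_AbelianMonoid) u n))
    (sum_n b) (Cmod l) B).
  - exists O; intros n _; induction n as [|n IH]; [rewrite !sum_O; apply Hle|].
    rewrite !sum_Sn; eapply Rle_trans; [apply Cmod_triangle|].
    now apply Rplus_le_compat.
  - eapply filterlim_comp; [exact Hu|].
    apply (filterlim_norm (K := C_AbsRing) (V := C_NormedModule)).
  - exact Hb.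
Qed.

(** * The exponential, roots of unity and averaging *)

Lemma cis2pi_add z w : cis2pi (z + w)%C = (cis2pi z * cis2pi w)%C.
Proof.
  unfold cis2pi; rewrite im_plus, re_plus, !Rmult_plus_distr_l, Ropp_plus_distr, exp_plus,
    cos_plus, sin_plus.
  unfold Cmult; simpl; f_equal; ring.
Qed.

Lemma cis2pi_0 : cis2pi (RtoC 0) = RtoC 1.
Proof.
  unfold cis2pi, RtoC; simpl; rewrite !Rmult_0_r, Ropp_0, exp_0, cos_0, sin_0; f_equal; ring.
Qed.

Lemma cis2pi_nat_mul (n : nat) z : cis2pi (RtoC (INR n) * z)%C = (cis2pi z ^ n)%C.
Proof.
  induction n as [|n IH].
  - rewrite Cmult_0_l; apply cis2pi_0.
  - rewrite S_INR, RtoC_plus, Cpow_S, <- IH, <- cis2pi_add; f_equal; ring.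
Qed.

Lemma Cmod_cis2pi z : Cmod (cis2pi z) = exp (- (2 * PI * Im z)).
Proof.
  unfold Cmod, cis2pi; simpl.
  replace (_ + _) with (exp (- (2 * PI * Im z)) * exp (- (2 * PI * Im z)) *
    (Rsqr (sin (2 * PI * Re z)) + Rsqr (cos (2 * PI * Re z)))) by (unfold Rsqr; ring).
  rewrite sin2_cos2, Rmult_1_r; apply sqrt_square, Rlt_le, exp_pos.
Qed.

Lemma cis2pi_neq_0 z : cis2pi z <> RtoC 0.
Proof.
  apply Cmod_gt_0; rewrite Cmod_cis2pi; apply exp_pos.
Qed.

Lemma cis2pi_1 : cis2pi (RtoC 1) = RtoC 1.
Proof.
  unfold cis2pi, RtoC; simpl.
  rewrite !Rmult_0_r, Ropp_0, exp_0, !Rmult_1_r, cos_2PI, sin_2PI; f_equal; ring.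
Qed.

(** The real part is [1 - 2 sin^2 (PI x)], and the sine is positive for [0 < x < 1]. *)
Lemma cis2pi_real_neq_1 (x : R) : 0 < x < 1 -> cis2pi (RtoC x) <> RtoC 1.
Proof.
  intros Hx E; apply (f_equal fst) in E; unfold cis2pi in E; simpl in E.
  rewrite Rmult_0_r, Ropp_0, exp_0, Rmult_1_l in E.
  replace (2 * PI * x) with (2 * (PI * x)) in E by ring.
  rewrite cos_2a_sin in E.
  pose proof PI_RGT_0.
  assert (0 < sin (PI * x)) by (apply sin_gt_0; nra).
  nra.
Qed.

Definition zeta (P : nat) : C := cis2pi (RtoC (/ INR P)).

Lemma zeta_pow (P n : nat) : (zeta P ^ n)%C = cis2pi (RtoC (INR n / INR P)).
Proof.
  unfold zeta; rewrite <- cis2pi_nat_mul, <- RtoC_mult; reflexivity.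
Qed.

Lemma zeta_pow_P (P : nat) : (0 < P)%nat -> (zeta P ^ P)%C = RtoC 1.
Proof.
  intros HP; rewrite zeta_pow; replace (INR P / INR P) with 1; [apply cis2pi_1|].
  field; apply not_0_INR; lia.
Qed.

(** Only [n mod P] matters, and its quotient by [P] lies strictly between 0 and 1. *)
Lemma zeta_pow_neq_1 (P n : nat) : (0 < P)%nat -> ~ Nat.divide P n -> (zeta P ^ n)%C <> RtoC 1.
Proof.
  intros HP Hn; rewrite (Nat.div_mod n P), Cpow_add_r, Cpow_mult_r, zeta_pow_P, Cpow_1_l by lia.
  rewrite Cmult_1_l, zeta_pow.
  apply cis2pi_real_neq_1.
  pose proof (Nat.mod_upper_bound n P ltac:(lia)) as H1.
  assert (H2 : (n mod P)%nat <> O) by (rewrite Nat.Lcm0.mod_divide; exact Hn).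
  apply lt_0_INR in HP as H3; apply lt_INR in H1.
  assert (H4 : 0 < INR (n mod P)%nat) by (apply lt_0_INR; lia).
  split; [now apply Rdiv_lt_0_compat|].
  apply (Rmult_lt_reg_r (INR P)); [exact H3|].
  unfold Rdiv; rewrite Rmult_assoc, Rinv_l; lra.
Qed.

Fixpoint geom_sum (w : C) (m : nat) : C :=
  match m with O => RtoC 0 | S m => (geom_sum w m + w ^ m)%C end.

Lemma geom_sum_eq w m : ((w - 1) * geom_sum w m = w ^ m - 1)%C.
Proof.
  induction m as [|m IH]; simpl; [ring|].
  rewrite Cmult_plus_distr_l, IH; ring.
Qed.

(** With [w = zeta^n], the product of [w - 1] and the sum is [w^P - 1 = 0], while [w] differs from
    1. *)
Lemma geom_sum_zeta (P n : nat) :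
  (0 < P)%nat -> ~ Nat.divide P n -> geom_sum (zeta P ^ n)%C P = RtoC 0.
Proof.
  intros HP Hn; pose proof (geom_sum_eq (zeta P ^ n)%C P) as E.
  rewrite <- Cpow_mult_r, Nat.mul_comm, Cpow_mult_r, zeta_pow_P, Cpow_1_l in E by exact HP.
  destruct (Ceq_dec (geom_sum (zeta P ^ n)%C P) (RtoC 0)) as [|N]; [assumption|].
  exfalso; refine (Cmult_neq_0 _ _ _ N _); [|rewrite E; ring].
  intros H; apply (zeta_pow_neq_1 P n HP Hn).
  replace (RtoC 1) with (zeta P ^ n - (zeta P ^ n - 1))%C by ring; rewrite H; ring.
Qed.

Lemma geom_sum_1 m : geom_sum (RtoC 1) m = RtoC (INR m).
Proof.
  induction m as [|m IH]; [reflexivity|].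
  simpl geom_sum; now rewrite IH, Cpow_1_l, S_INR, RtoC_plus.
Qed.

(** Adding the hypotheses for [k < P] multiplies the coefficient of index [n] by the sum of the
    [zeta^(n k)], which is [P] if [P] divides [n] and 0 otherwise. Decimating and dividing by [P]
    gives the claim. *)
Lemma is_Cseries_average (P : nat) (c : nat -> C) (x L : C) : (0 < P)%nat ->
  (forall k, is_Cseries (fun n => (c n * (zeta P ^ k * x) ^ n)%C) L) ->
  is_Cseries (fun n => (c (P * n)%nat * (x ^ P) ^ n)%C) L.
Proof.
  intros HP H.
  assert (Hm : forall m, is_Cseries
    (fun n => (geom_sum (zeta P ^ n)%C m * (c n * x ^ n))%C) (RtoC (INR m) * L)%C).
  { induction m as [|m IH].
    - eapply is_Cseries_ext; [|exact (is_Cseries_scal (RtoC 0) _ _ (H O))].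
      intros n; simpl; ring.
    - rewrite S_INR, RtoC_plus, Cmult_plus_distr_r, Cmult_1_l.
      eapply is_Cseries_ext; [|exact (is_Cseries_plus _ _ _ _ IH (H m))].
      intros n; cbv beta.
      change (geom_sum (zeta P ^ n)%C (S m)) with
        (geom_sum (zeta P ^ n)%C m + (zeta P ^ n) ^ m)%C.
      rewrite Cpow_mult_l, <- !Cpow_mult_r, (Nat.mul_comm n m); ring. }
  assert (HPC : RtoC (INR P) <> RtoC 0).
  { intros E; apply RtoC_inj in E; revert E; apply not_0_INR; lia. }
  assert (HD := Hm P); apply (is_Cseries_decimate P) in HD; [|exact HP|];
    [|intros n Hn; rewrite geom_sum_zeta by assumption; ring].
  apply (is_Cseries_scal (/ RtoC (INR P))%C) in HD.
  rewrite Cmult_assoc, Cinv_l, Cmult_1_l in HD by exact HPC.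
  eapply is_Cseries_ext; [|exact HD]; intros n; cbv beta.
  rewrite (Cpow_mult_r (zeta P)), zeta_pow_P, Cpow_1_l, geom_sum_1, Cpow_mult_r by exact HP.
  rewrite Cmult_assoc, Cinv_l, Cmult_1_l by exact HPC; reflexivity.
Qed.

(** * Punctured neighbourhoods and expansions at the cusp *)

Lemma Im_scal (k : R) (t : C) : Im (RtoC k * t)%C = k * Im t.
Proof. destruct t as [x y]; unfold Im; simpl; ring. Qed.

Lemma cis2pi_q_term (kappa : R) n (t : C) :
  cis2pi (RtoC ((kappa + INR n) / 1) * t)%C = (cis2pi (RtoC kappa * t) * cis2pi t ^ n)%C.
Proof.
  rewrite <- cis2pi_nat_mul, <- cis2pi_add; f_equal.
  unfold Rdiv; rewrite Rinv_1, Rmult_1_r, RtoC_plus; ring.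
Qed.

Lemma locally'_and (z : C) (A B : C -> Prop) :
  locally' z A -> locally' z B -> locally' z (fun t => A t /\ B t).
Proof.
  apply (filter_and (F := locally' z)).
Qed.

Lemma locally'_imp (z : C) (A B : C -> Prop) :
  (forall t, A t -> B t) -> locally' z A -> locally' z B.
Proof.
  apply (filter_imp (F := locally' z)).
Qed.

(** Values are controlled only on punctured neighbourhoods. This gives an actual point at an
    unchanged height, and for real [k] the modulus of [cis2pi (k t)] depends only on the height. *)
Lemma locally'_horizontal (z : C) (A : C -> Prop) :
  locally' z A -> exists t, A t /\ Im t = Im z.
Proof.
  intros [d Hd]; exists (z + RtoC (d / 2))%C; split.
  - pose proof (cond_pos d) as Hp; apply Hd.
    + split; unfold ball; simpl; unfold AbsRing_ball, minus, plus, opp, abs; simpl.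
      * replace (_ + _) with (d / 2) by (destruct z; simpl; ring).
        rewrite Rabs_pos_eq; lra.
      * replace (_ + _) with 0 by (destruct z; simpl; ring).
        rewrite Rabs_R0; exact Hp.
    + intros E; apply (f_equal fst) in E; simpl in E; lra.
  - rewrite im_plus, im_RtoC; ring.
Qed.

Lemma locally'_Im_gt (z : C) (Y : R) : Y < Im z -> locally' z (fun t => Y < Im t).
Proof.
  intros H.
  assert (Hd : 0 < Im z - Y) by lra.
  exists (mkposreal _ Hd); intros t [_ H2] _.
  unfold ball in H2; simpl in H2; unfold AbsRing_ball, minus, plus, opp, abs in H2; simpl in H2.
  apply Rabs_def2 in H2; unfold Im in *; lra.
Qed.

(** Division by [P >= 1] does not increase distances, so the same radius works; injectivity of the
    map keeps the centre excluded. *)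
Lemma locally'_affine (z : C) (j P : R) (A : C -> Prop) : 1 <= P ->
  locally' ((z + RtoC j) / RtoC P)%C A -> locally' z (fun t => A ((t + RtoC j) / RtoC P)%C).
Proof.
  intros HP [d Hd]; exists d; intros t [H1 H2] Ht; apply Hd.
  - assert (E : forall w : C, ((w + RtoC j) / RtoC P)%C = (((fst w + j) / P, snd w / P) : C)).
    { intros [x y]; unfold Cdiv; rewrite <- RtoC_inv by lra; unfold Cmult, Cplus, RtoC; simpl.
      f_equal; field; lra. }
    assert (L : forall u : R, Rabs u < d -> Rabs (u / P) < d).
    { intros u Hu; unfold Rdiv; rewrite Rabs_mult, (Rabs_pos_eq (/ P))
        by (apply Rlt_le, Rinv_0_lt_compat; lra).
      apply Rle_lt_trans with (Rabs u * 1); [|lra].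
      apply Rmult_le_compat_l; [apply Rabs_pos|].
      rewrite <- Rinv_1; apply Rinv_le_contravar; lra. }
    unfold ball in H1, H2; simpl in H1, H2.
    unfold AbsRing_ball, minus, plus, opp, abs in H1, H2; simpl in H1, H2.
    rewrite !E; split; unfold ball; simpl; unfold AbsRing_ball, minus, plus, opp, abs; simpl.
    + replace (_ + _) with ((fst t + - fst z) / P) by (field; lra); auto.
    + replace (_ + _) with ((snd t + - snd z) / P) by (field; lra); auto.
  - intros E; apply Ht; revert E; generalize (t : C) as w; intros w E.
    assert (HPC : RtoC P <> RtoC 0) by (intros E0; apply RtoC_inj in E0; lra).
    apply (f_equal (fun u : C => u * RtoC P - RtoC j)%C) in E.
    assert (F : forall u : C, ((u + RtoC j) / RtoC P * RtoC P - RtoC j)%C = u)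
      by (intros u; field; exact HPC).
    now rewrite !F in E.
Qed.

(** Abel's argument: convergence at a point [w] of height [y] strictly between [Y] and [Im t] bounds
    the terms there, and passing to [t] gains the factor [q^n] of a geometric series with
    [q < 1]. *)
Lemma q_expansion_abs_summable kappa a f : q_expansion 1 kappa a f ->
  exists Y, forall t, Y < Im t -> abs_summable (fun n => (a n * cis2pi t ^ n)%C).
Proof.
  intros [Y HY]; exists Y; intros t Ht.
  set (y := (Y + Im t) / 2).
  destruct (locally'_horizontal (0, y)%R _ (HY (0, y)%R ltac:(unfold y; simpl; lra)))
    as [w [Hw Ew]].
  simpl in Ew; apply is_Cseries_bounded in Hw; destruct Hw as [M HM].
  assert (Hpos : 0 < Cmod (cis2pi (RtoC kappa * w)%C)) by apply Cmod_gt_0, cis2pi_neq_0.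
  set (K := Cmod (cis2pi (RtoC kappa * w)%C)) in *.
  set (q := exp (- (2 * PI * (Im t - y)))).
  assert (Hq : 0 < q < 1).
  { split; [apply exp_pos|]; unfold q; rewrite <- exp_0; apply exp_increasing.
    pose proof PI_RGT_0; assert (0 < Im t - y) by (unfold y; lra).
    assert (0 < PI * (Im t - y)) by now apply Rmult_lt_0_compat. lra. }
  apply (ex_series_le (K := R_AbsRing) (V := R_CompleteNormedModule)) with
    (b := fun n => M / K * q ^ n).
  - intros n; change (Rabs (Cmod (a n * cis2pi t ^ n)%C) <= M / K * q ^ n).
    rewrite Rabs_pos_eq by apply Cmod_ge_0.
    specialize (HM n); rewrite cis2pi_q_term, !Cmod_mult, Cmod_pow in HM; fold K in HM.
    rewrite Cmod_mult, Cmod_pow.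
    replace (Cmod (cis2pi t)) with (Cmod (cis2pi w) * q).
    + rewrite Rpow_mult_distr, <- Rmult_assoc; apply Rmult_le_compat_r.
      * apply pow_le; lra.
      * apply (Rmult_le_reg_r K); [exact Hpos|].
        unfold Rdiv; rewrite (Rmult_assoc M), Rinv_l; lra.
    + rewrite !Cmod_cis2pi; unfold q; rewrite <- exp_plus, Ew; f_equal; ring.
  - apply (ex_series_scal_l (K := R_AbsRing) (V := R_NormedModule) (M / K)).
    apply ex_series_geom; rewrite Rabs_pos_eq; lra.
Qed.

(** Splitting off the factor with the real exponent [kappa] leaves a genuine power series in
    [cis2pi t], to which Cauchy products apply. *)
Lemma q_expansion_pseries kappa a f : q_expansion 1 kappa a f ->
  exists Y, (forall t, Y < Im t -> abs_summable (fun n => (a n * cis2pi t ^ n)%C)) /\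
    forall z, Y < Im z -> locally' z (fun t => exists l,
      is_Cseries (fun n => (a n * cis2pi t ^ n)%C) l /\ f t = (cis2pi (RtoC kappa * t) * l)%C).
Proof.
  intros H; destruct (q_expansion_abs_summable _ _ _ H) as [Y1 H1]; destruct H as [Y2 H2].
  exists (Rmax Y1 Y2); split.
  - intros t Ht; apply H1; pose proof (Rmax_l Y1 Y2); lra.
  - intros z Hz; pose proof (Rmax_r Y1 Y2).
    generalize (H2 z ltac:(lra)); apply locally'_imp; intros t Ht.
    pose proof (cis2pi_neq_0 (RtoC kappa * t)%C) as Hn.
    exists (/ cis2pi (RtoC kappa * t) * f t)%C; split.
    + eapply is_Cseries_ext; [|exact (is_Cseries_scal (/ cis2pi (RtoC kappa * t))%C _ _ Ht)].
      intros n; cbv beta; rewrite cis2pi_q_term; field; exact Hn.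
    + field; exact Hn.
Qed.

Lemma q_expansion_asymptotic kappa a f (eps : R) : q_expansion 1 kappa a f -> 0 < eps ->
  exists Y, forall z, Y < Im z -> locally' z (fun t =>
    Cmod (f t - a O * cis2pi (RtoC kappa * t))%C <= eps * Cmod (cis2pi (RtoC kappa * t)%C)).
Proof.
  intros H Heps; destruct (q_expansion_pseries _ _ _ H) as [Y [HA HS]].
  (* A fixed reference point. The sum [B] of the moduli at [t0] bounds the tail from index 1 at a
     higher [t] by [q * B], with [q] the ratio of [Cmod (cis2pi t)] to [Cmod (cis2pi t0)]. *)
  set (t0 := (0, Y + 1)%R : C).
  destruct (HA t0 ltac:(simpl; lra)) as [B HSt0].
  assert (HB0 : 0 <= B).
  { rewrite <- Cmod_0; apply (is_Cseries_Cmod_le _ _ _ _ (is_Cseries_delta (RtoC 0)) HSt0).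
    intros [|n]; rewrite Cmod_0; apply Cmod_ge_0. }
  exists (Rmax (Y + 1) (Y + 1 + B / eps)); intros z Hz.
  pose proof (Rmax_l (Y + 1) (Y + 1 + B / eps)); pose proof (Rmax_r (Y + 1) (Y + 1 + B / eps)).
  generalize (locally'_and _ _ _ (HS z ltac:(lra))
    (locally'_Im_gt z (Rmax (Y + 1) (Y + 1 + B / eps)) Hz)).
  apply locally'_imp; intros t [[l [Hl ->]] Ht].
  replace (cis2pi (RtoC kappa * t) * l - a O * cis2pi (RtoC kappa * t))%C
    with ((l + - a O) * cis2pi (RtoC kappa * t))%C by ring.
  rewrite Cmod_mult; apply Rmult_le_compat_r; [apply Cmod_ge_0|].
  set (q := exp (- (2 * PI * (Im t - (Y + 1))))).
  assert (Hq : 0 < q <= 1).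
  { split; [apply exp_pos|]; apply Rle_trans with (exp 0); [|rewrite exp_0; lra].
    apply Rlt_le, exp_increasing.
    pose proof PI_RGT_0; assert (0 < PI * (Im t - (Y + 1))) by (apply Rmult_lt_0_compat; lra).
    lra. }
  assert (Eq : Cmod (cis2pi t) = Cmod (cis2pi t0) * q).
  { rewrite !Cmod_cis2pi; unfold q; rewrite <- exp_plus; f_equal; simpl; ring. }
  apply Rle_trans with (q * B).
  - apply (is_Cseries_Cmod_le _ _ _ _
      (is_Cseries_plus _ _ _ _ Hl (is_Cseries_delta (- a O)%C))
      (is_series_scal_l (K := R_AbsRing) (V := R_NormedModule) q _ _ HSt0)).
    intros n; change (scal q (Cmod (a n * cis2pi t0 ^ n)%C)) with
      (q * Cmod (a n * cis2pi t0 ^ n)%C).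
    destruct n as [|n].
    + replace (a O * cis2pi t ^ 0 + - a O)%C with (RtoC 0) by (simpl; ring).
      rewrite Cmod_0; apply Rmult_le_pos; [lra|apply Cmod_ge_0].
    + rewrite Cplus_0_r, !Cmod_mult, !Cmod_pow, Eq, Rpow_mult_distr.
      replace (q * (Cmod (a (S n)) * Cmod (cis2pi t0) ^ S n)) with
        (Cmod (a (S n)) * (Cmod (cis2pi t0) ^ S n * q)) by ring.
      apply Rmult_le_compat_l; [apply Cmod_ge_0|].
      apply Rmult_le_compat_l; [apply pow_le, Cmod_ge_0|].
      simpl; rewrite <- (Rmult_1_r q) at 3; apply Rmult_le_compat_l; [lra|].
      rewrite <- (pow1 n); apply pow_incr; lra.
  - assert (HX : B / eps < Im t - (Y + 1)) by lra.
    (* With [X = Im t - (Y + 1) > B / eps], one has [B / eps < X <= exp (2 PI X)], and this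
       exponential is the inverse of [q]. *)
    assert (Hq2 : q * (B / eps) <= 1).
    { assert (HB1 : 0 <= B / eps) by (apply Rdiv_le_0_compat; lra).
      set (X := Im t - (Y + 1)) in *.
      pose proof PI_RGT_0; pose proof PI2_1 as HPI.
      pose proof (exp_ineq1_le (2 * PI * X)) as HE.
      assert (E : q * exp (2 * PI * X) = 1).
      { unfold q; rewrite <- exp_plus, Rplus_opp_l; apply exp_0. }
      rewrite <- E; apply Rmult_le_compat_l; [lra|]; unfold PI2 in HPI; nra. }
    replace (q * B) with (q * (B / eps) * eps) by (field; lra).
    nra.
Qed.

(** * Uniqueness of the normalizing constant *)

Lemma dominant_exponent_ge (g : C -> C) (c1 c2 : C) (k1 k2 a1 a2 : R) :
  0 < a1 -> c2 <> RtoC 0 ->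
  (exists Y, forall z, Y < Im z -> locally' z (fun t =>
    a1 * Cmod (cis2pi (RtoC k1 * t)%C) <= Cmod (c1 * g t)%C)) ->
  (exists Y, forall z, Y < Im z -> locally' z (fun t =>
    Cmod (c2 * g t)%C <= a2 * Cmod (cis2pi (RtoC k2 * t)%C))) ->
  k2 <= k1.
Proof.
  intros Ha1 Hc2 [Y1 H1] [Y2 H2]; apply Rnot_lt_le; intros Hk.
  apply Cmod_gt_0 in Hc2; pose proof (Cmod_ge_0 c1) as Hc1.
  set (A := Cmod c2 * a1); set (B := Cmod c1 * a2).
  assert (HA : 0 < A) by now apply Rmult_lt_0_compat.
  pose proof PI_RGT_0 as Hpi.
  assert (Hd : 0 < 2 * PI * (k2 - k1)) by (apply Rmult_lt_0_compat; lra).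
  set (d := 2 * PI * (k2 - k1)) in *.
  (* High enough for both hypotheses, and such that [A * (d * y) >= Rabs B]. As
     [exp (d y) >= 1 + d y], this contradicts the bound [A * exp (d * y) <= B] that comes from
     comparing both estimates through [Cmod c1 * Cmod c2 * Cmod (g t)]. *)
  set (y := Rabs Y1 + Rabs Y2 + Rabs B / (A * d) + 1).
  pose proof (Rle_abs Y1); pose proof (Rle_abs Y2).
  pose proof (Rabs_pos Y1); pose proof (Rabs_pos Y2).
  assert (HB : 0 <= Rabs B / (A * d)).
  { apply Rdiv_le_0_compat; [apply Rabs_pos|now apply Rmult_lt_0_compat]. }
  destruct (locally'_horizontal _ _ (locally'_and _ _ _
    (H1 (0, y)%R ltac:(unfold y; simpl; lra)) (H2 (0, y)%R ltac:(unfold y; simpl; lra))))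
    as [t [[L1 L2] Ht]]; simpl in Ht.
  rewrite Cmod_mult, Cmod_cis2pi, Im_scal, Ht in L1, L2.
  set (E1 := exp (- (2 * PI * (k1 * y)))) in *.
  set (E2 := exp (- (2 * PI * (k2 * y)))) in *.
  assert (EE : E1 = E2 * exp (d * y)).
  { unfold E1, E2, d; rewrite <- exp_plus; f_equal; ring. }
  assert (HE2 : 0 < E2) by apply exp_pos.
  assert (L3 : A * exp (d * y) <= B).
  { apply (Rmult_le_reg_l E2); [exact HE2|].
    apply Rle_trans with (Cmod c2 * (Cmod c1 * Cmod (g t))).
    - replace (E2 * (A * exp (d * y))) with (Cmod c2 * (a1 * E1)) by (rewrite EE; unfold A; ring).
      apply Rmult_le_compat_l; lra.
    - replace (E2 * B) with (Cmod c1 * (a2 * E2)) by (unfold B; ring).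
      replace (Cmod c2 * (Cmod c1 * Cmod (g t))) with (Cmod c1 * (Cmod c2 * Cmod (g t))) by ring.
      apply Rmult_le_compat_l; lra. }
  pose proof (exp_ineq1_le (d * y)) as L4.
  assert (L5 : Rabs B <= A * (d * y)).
  { replace (Rabs B) with (A * (d * (Rabs B / (A * d)))) by (field; lra).
    repeat (apply Rmult_le_compat_l; [lra|]); unfold y; lra. }
  pose proof (Rle_abs B).
  assert (A * (1 + d * y) <= B) by (apply Rle_trans with (2 := L3), Rmult_le_compat_l; lra).
  lra.
Qed.

Lemma leading_coef_scal_unique (g : C -> C) (c1 c2 : C) :
  leading_coef (fun t => (c1 * g t)%C) (RtoC 1) ->
  leading_coef (fun t => (c2 * g t)%C) (RtoC 1) -> c1 = c2.
Proof.
  intros [_ [k1 [a1 [E1 Q1]]]] [_ [k2 [a2 [E2 Q2]]]].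
  (* The asymptotic with [eps = 1/2] traps the modulus between two positive multiples of the
     exponential. Used in both directions, this forces the two exponents to agree. *)
  assert (half : forall c k a, a O = RtoC 1 -> q_expansion 1 k a (fun t => (c * g t)%C) ->
    exists Y, forall z, Y < Im z -> locally' z (fun t =>
      / 2 * Cmod (cis2pi (RtoC k * t)%C) <= Cmod (c * g t)%C /\
      Cmod (c * g t)%C <= 3 / 2 * Cmod (cis2pi (RtoC k * t)%C))).
  { intros c k a E Q.
    destruct (q_expansion_asymptotic _ _ _ (/ 2) Q ltac:(lra)) as [Y HY].
    exists Y; intros z Hz; generalize (HY z Hz); apply locally'_imp; intros t Ht.
    rewrite E, Cmult_1_l in Ht.
    split.
    - pose proof (Cmod_triangle (c * g t)%C (- (c * g t - cis2pi (RtoC k * t)))%C) as T.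
      rewrite Cmod_opp in T.
      replace (c * g t + - (c * g t - cis2pi (RtoC k * t)))%C with (cis2pi (RtoC k * t)) in T
        by ring.
      lra.
    - pose proof (Cmod_triangle (cis2pi (RtoC k * t)%C) (c * g t - cis2pi (RtoC k * t))%C) as T.
      replace (cis2pi (RtoC k * t) + (c * g t - cis2pi (RtoC k * t)))%C with (c * g t)%C in T
        by ring.
      lra. }
  assert (nz : forall c k a, a O = RtoC 1 -> q_expansion 1 k a (fun t => (c * g t)%C) ->
    c <> RtoC 0).
  { intros c k a E Q ->; destruct (half _ _ _ E Q) as [Y HY].
    destruct (locally'_horizontal _ _ (HY (0, Y + 1)%R ltac:(simpl; lra))) as [t [[H _] _]].
    rewrite Cmult_0_l, Cmod_0 in H.
    pose proof (proj1 (Cmod_gt_0 _) (cis2pi_neq_0 (RtoC k * t)%C)); lra. }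
  assert (mono : forall c c' k k' a a', a O = RtoC 1 -> a' O = RtoC 1 ->
    q_expansion 1 k a (fun t => (c * g t)%C) -> q_expansion 1 k' a' (fun t => (c' * g t)%C) ->
    k' <= k).
  { intros c c' k k' a a' E E' Q Q'.
    destruct (half _ _ _ E Q) as [Y HY]; destruct (half _ _ _ E' Q') as [Y' HY'].
    apply (dominant_exponent_ge g c c' k k' (/ 2) (3 / 2)); [lra|exact (nz _ _ _ E' Q')| |].
    - exists Y; intros z Hz; generalize (HY z Hz); apply locally'_imp; now intros t [].
    - exists Y'; intros z Hz; generalize (HY' z Hz); apply locally'_imp; now intros t []. }
  assert (Ek : k1 = k2) by (apply Rle_antisym;
    [exact (mono _ _ _ _ _ _ E2 E1 Q2 Q1)|exact (mono _ _ _ _ _ _ E1 E2 Q1 Q2)]).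
  subst k2; clear mono half.
  pose proof (nz _ _ _ E1 Q1) as N1; apply Cmod_gt_0 in N1; clear nz.
  pose proof (Cmod_ge_0 c2) as N2.
  destruct (Ceq_dec c1 c2) as [|N]; [assumption|exfalso].
  assert (Hd : 0 < Cmod (c2 - c1)%C).
  { apply Cmod_gt_0; intros E; apply N.
    transitivity (c2 - (c2 - c1))%C; [ring|rewrite E; ring]. }
  (* Chosen so that the error [(Cmod c1 + Cmod c2) * eps] is half of [Cmod (c2 - c1)]; the
     denominator is positive because [c1] is nonzero. *)
  set (eps := Cmod (c2 - c1)%C / (2 * (Cmod c1 + Cmod c2))).
  assert (Heps : 0 < eps) by (apply Rdiv_lt_0_compat; lra).
  destruct (q_expansion_asymptotic _ _ _ eps Q1 Heps) as [Y1 H1].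
  destruct (q_expansion_asymptotic _ _ _ eps Q2 Heps) as [Y2 H2].
  pose proof (Rle_abs Y1); pose proof (Rle_abs Y2).
  pose proof (Rabs_pos Y1); pose proof (Rabs_pos Y2).
  destruct (locally'_horizontal _ _ (locally'_and _ _ _
    (H1 (0, Rabs Y1 + Rabs Y2 + 1)%R ltac:(simpl; lra))
    (H2 (0, Rabs Y1 + Rabs Y2 + 1)%R ltac:(simpl; lra))))
    as [t [[L1 L2] _]].
  rewrite E1, Cmult_1_l in L1; rewrite E2, Cmult_1_l in L2.
  set (e := cis2pi (RtoC k1 * t)%C) in *.
  assert (He : 0 < Cmod e) by apply Cmod_gt_0, cis2pi_neq_0.
  (* The unknown [g t] cancels in [(c2 - c1) e = c1 (c2 g - e) - c2 (c1 g - e)]. *)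
  assert (L : Cmod (c2 - c1)%C * Cmod e <= Cmod c1 * (eps * Cmod e) + Cmod c2 * (eps * Cmod e)).
  { rewrite <- Cmod_mult.
    replace ((c2 - c1) * e)%C with (c1 * (c2 * g t - e) + - (c2 * (c1 * g t - e)))%C by ring.
    eapply Rle_trans; [apply Cmod_triangle|].
    rewrite Cmod_opp, !Cmod_mult.
    apply Rplus_le_compat; apply Rmult_le_compat_l; lra. }
  assert (L' : Cmod (c2 - c1)%C <= (Cmod c1 + Cmod c2) * eps).
  { apply (Rmult_le_reg_r (Cmod e)); [exact He|lra]. }
  unfold eps in L'.
  replace ((Cmod c1 + Cmod c2) * (Cmod (c2 - c1)%C / (2 * (Cmod c1 + Cmod c2))))
    with (Cmod (c2 - c1)%C / 2) in L' by (field; lra).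
  lra.
Qed.

(** * The product over translates and its expansion *)

Definition translate_prod (P : nat) (f : C -> C) (t : C) : C :=
  Cprod P (fun j => f ((t + RtoC (INR j)) / RtoC (INR P))%C).

Lemma RtoC_INR_neq_0 n : (0 < n)%nat -> RtoC (INR n) <> RtoC 0.
Proof.
  intros Hn E; apply RtoC_inj in E; revert E; apply not_0_INR; lia.
Qed.

Lemma Cinv_neq_0 c : c <> RtoC 0 -> (/ c)%C <> RtoC 0.
Proof.
  intros Hc; apply Cmod_gt_0; rewrite Cmod_inv by exact Hc.
  now apply Rinv_0_lt_compat, Cmod_gt_0.
Qed.

Lemma translate_prod_scal P c f t :
  translate_prod P (fun t => (c * f t)%C) t = (c ^ P * translate_prod P f t)%C.
Proof.
  unfold translate_prod; now rewrite Cprod_mult, Cprod_const.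
Qed.

Lemma translate_prod_comp P Q f t : (0 < P)%nat -> (0 < Q)%nat ->
  translate_prod Q (translate_prod P f) t = translate_prod (P * Q) f t.
Proof.
  intros HP HQ; unfold translate_prod; rewrite <- Cprod_Cprod.
  apply Cprod_ext; intros i _; apply Cprod_ext; intros j _; f_equal.
  rewrite plus_INR, !mult_INR, RtoC_plus, !RtoC_mult.
  pose proof (RtoC_INR_neq_0 P HP); pose proof (RtoC_INR_neq_0 Q HQ); field; auto.
Qed.

Lemma locally'_forall_lt (z : C) (P : nat) (A : nat -> C -> Prop) :
  (forall j, (j < P)%nat -> locally' z (A j)) ->
  locally' z (fun t => forall j, (j < P)%nat -> A j t).
Proof.
  induction P as [|P IH]; intros H.
  - apply (filter_forall (F := locally' z)); intros t j Hj; lia.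
  - generalize (locally'_and _ _ _ (IH (fun j Hj => H j ltac:(lia))) (H P ltac:(lia))).
    apply locally'_imp; intros t [H1 H2] j Hj.
    destruct (Nat.eq_dec j P) as [->|]; [exact H2|apply H1; lia].
Qed.

(** The exponent stays [kappa]: each of the [P] factors contributes [kappa / P]. *)
Lemma q_expansion_translate_prod P kappa a f : (0 < P)%nat -> a O <> RtoC 0 ->
  q_expansion 1 kappa a f ->
  exists b, b O <> RtoC 0 /\ q_expansion 1 kappa b (translate_prod P f).
Proof.
  intros HP Ha Hf.
  pose proof (RtoC_INR_neq_0 P HP) as HPC.
  assert (HPR : 1 <= INR P) by (apply (le_INR 1); lia).
  (* Twisting the coefficients by [(zeta^j)^n] turns the factor at [(t + j) / P] into a power series
     in the common variable [x]. *)
  destruct (Cprod_pseries P (fun j n => a n * (zeta P ^ j) ^ n)%C) as [c [c0 Hc]].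
  (* The constant part of the split-off exponentials, coming from the shifts [j / P]. *)
  set (D := Cprod P (fun j => cis2pi (RtoC kappa * (RtoC (INR j) / RtoC (INR P)))%C)).
  exists (fun n => D * c (P * n)%nat)%C; split.
  { rewrite Nat.mul_0_r, c0; apply Cmult_neq_0; apply Cprod_neq_0; intros j.
    - apply cis2pi_neq_0.
    - simpl; rewrite Cmult_1_r; exact Ha. }
  destruct (q_expansion_pseries _ _ _ Hf) as [Y [HA HS]].
  assert (HIm : forall (t : C) j, INR P * Y < Im t ->
    Y < Im ((t + RtoC (INR j)) / RtoC (INR P))%C).
  { intros t j Ht.
    replace ((t + RtoC (INR j)) / RtoC (INR P))%C with
      (RtoC (/ INR P) * (t + RtoC (INR j)))%C by (rewrite RtoC_inv by lra; field; exact HPC).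
    rewrite Im_scal, im_plus, im_RtoC, Rplus_0_r.
    apply (Rmult_lt_reg_l (INR P)); [lra|].
    rewrite <- Rmult_assoc, Rinv_r; lra. }
  exists (INR P * Y); intros z Hz.
  generalize (locally'_and _ _ _ (locally'_Im_gt z _ Hz)
    (locally'_forall_lt z P _ (fun j _ => locally'_affine z (INR j) (INR P) _ HPR
      (HS _ (HIm z j Hz))))).
  apply locally'_imp; intros t [Ht Hl].
  set (x := cis2pi (t / RtoC (INR P))%C).
  assert (Hx : forall j, cis2pi ((t + RtoC (INR j)) / RtoC (INR P))%C = (zeta P ^ j * x)%C).
  { intros j; unfold zeta, x; rewrite <- cis2pi_nat_mul, <- cis2pi_add; f_equal.
    rewrite RtoC_inv by lra; field; exact HPC. }
  set (A := fun j => CSeries (fun n => (a n * (zeta P ^ j * x) ^ n)%C)).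
  assert (Habs : forall j, abs_summable (fun n => (a n * (zeta P ^ j * x) ^ n)%C)).
  { intros j; rewrite <- Hx; apply HA, HIm, Ht. }
  assert (HAs : forall j, is_Cseries (fun n => (a n * (zeta P ^ j * x) ^ n)%C) (A j))
    by (intros j; apply CSeries_correct, Habs).
  assert (Hper : forall j, A (j + P)%nat = A j).
  { intros j; unfold A; rewrite Cpow_add_r; rewrite (zeta_pow_P P HP).
    now rewrite Cmult_1_r. }
  (* Replacing [x] by [zeta^k x] shifts the index [j] by [k], which leaves the product of the
     periodic family [A] unchanged. *)
  assert (Hrot : forall k, is_Cseries (fun n => (c n * (zeta P ^ k * x) ^ n)%C) (Cprod P A)).
  { intros k; rewrite <- (Cprod_periodic P A k Hper).
    assert (E : forall j n, (a n * (zeta P ^ (j + k) * x) ^ n)%C =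
      (a n * (zeta P ^ j) ^ n * (zeta P ^ k * x) ^ n)%C).
    { intros j n; rewrite Cpow_add_r, !Cpow_mult_l; ring. }
    apply Hc; intros j.
    - eapply ex_series_ext; [|exact (Habs (j + k)%nat)].
      intros n; cbv beta; now rewrite E.
    - eapply is_Cseries_ext; [|exact (HAs (j + k)%nat)].
      intros n; apply E. }
  apply (is_Cseries_average P _ _ _ HP) in Hrot.
  replace (translate_prod P f t) with (D * cis2pi (RtoC kappa * t) * Cprod P A)%C.
  - eapply is_Cseries_ext; [|exact (is_Cseries_scal (D * cis2pi (RtoC kappa * t))%C _ _ Hrot)].
    intros n; cbv beta; rewrite cis2pi_q_term.
    replace (cis2pi t) with (x ^ P)%C; [ring|].
    unfold x; rewrite <- cis2pi_nat_mul; f_equal; field; exact HPC.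
  - transitivity (Cprod P (fun j => cis2pi (RtoC kappa * (RtoC (INR j) / RtoC (INR P))) *
      cis2pi (RtoC kappa * (t / RtoC (INR P))) * A j)%C).
    + rewrite !Cprod_mult, Cprod_const; fold D; do 2 f_equal.
      rewrite <- cis2pi_nat_mul; f_equal; field; exact HPC.
    + apply Cprod_ext; intros j Hj; destruct (Hl j Hj) as [l [Hs ->]].
      rewrite Hx in Hs; rewrite (is_Cseries_unique _ _ _ Hs (HAs j)), <- cis2pi_add.
      do 2 f_equal; field; exact HPC.
Qed.

(** * The operators and their composition *)

Lemma q_expansion_scal h kappa a f c : q_expansion h kappa a f ->
  q_expansion h kappa (fun n => c * a n)%C (fun t => c * f t)%C.
Proof.
  intros [Y HY]; exists Y; intros z Hz; generalize (HY z Hz); apply locally'_imp; intros t Ht.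
  eapply is_Cseries_ext; [|exact (is_Cseries_scal c _ _ Ht)].
  intros n; cbv beta; ring.
Qed.

(** For the matrices [[1, j; 0, P]] the automorphy factor is the constant [P]. Each slash thus
    contributes the same scalar [k0], and [K] collects its power [k0^P] and the prefactor. *)
Lemma mulT_raw_translate_prod p r F : (0 < p)%nat ->
  exists K, K <> RtoC 0 /\ mulT_raw p r F = (fun t => K * translate_prod (p ^ r) (fn F) t)%C.
Proof.
  intros Hp.
  assert (HP : (0 < p ^ r)%nat) by (apply Nat.neq_0_lt_0, Nat.pow_nonzero; lia).
  assert (HPC := RtoC_INR_neq_0 _ HP).
  unfold mulT_raw; set (P := (p ^ r)%nat) in *.
  set (k0 := (RtoC (Rpower (INR P) (IZR (wt F) / 2)) * Cpowz (RtoC (INR P)) (- wt F))%C).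
  assert (Hpow : forall x y, RtoC (Rpower x y) <> RtoC 0).
  { intros x y E; apply RtoC_inj in E; pose proof (exp_pos (y * ln x)).
    unfold Rpower in E; lra. }
  assert (Hk0 : k0 <> RtoC 0).
  { apply Cmult_neq_0; [apply Hpow|].
    destruct (- wt F)%Z; simpl.
    - intros E; apply RtoC_inj in E; lra.
    - now apply Cpow_nz.
    - now apply Cinv_neq_0, Cpow_nz. }
  exists (RtoC (Rpower (INR p) (INR r * IZR (wt F) * INR P / 2)) * k0 ^ P)%C; split.
  { apply Cmult_neq_0; [apply Hpow|now apply Cpow_nz]. }
  apply functional_extensionality; intros t.
  rewrite <- Cmult_assoc; f_equal.
  unfold translate_prod; rewrite <- Cprod_const, <- Cprod_mult; apply Cprod_ext; intros j _.
  unfold slash, k0, mobius.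
  replace (autfactor (Mat2 1 (Z.of_nat j) 0 (Z.of_nat P)) t) with (RtoC (INR P)).
  - unfold mdet; simpl ma; simpl mb; simpl mc; simpl md.
    rewrite Z.mul_0_r, Z.sub_0_r, Z.mul_1_l, <- !INR_IZR_INZ, Cmult_1_l; reflexivity.
  - unfold autfactor; simpl mc; simpl md; rewrite <- INR_IZR_INZ; ring.
Qed.

(** The second conclusion reproduces the hypothesis on [F], so the lemma can be applied again to the
    image. *)
Lemma mulT_spec p r F : (0 < p)%nat -> leading_coef (fn F) (RtoC 1) ->
  (exists c, forall t, fn (mulT p r F) t = (c * translate_prod (p ^ r) (fn F) t)%C) /\
  leading_coef (fn (mulT p r F)) (RtoC 1).
Proof.
  intros Hp [H1 [kappa [a [a0 Ha]]]].
  destruct (mulT_raw_translate_prod p r F Hp) as [K [HK ER]].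
  assert (HP : (0 < p ^ r)%nat) by (apply Nat.neq_0_lt_0, Nat.pow_nonzero; lia).
  destruct (q_expansion_translate_prod _ _ _ _ HP ltac:(now rewrite a0) Ha) as [b [b0 Hb]].
  split.
  - exists (normalizer (mulT_raw p r F) * K)%C; intros t; simpl; rewrite ER; simpl; ring.
  - assert (L : leading_coef (fun t => / (b O * K) * mulT_raw p r F t)%C (RtoC 1)).
    { split; [exact H1|].
      exists kappa, (fun n => / b O * b n)%C; split; [now apply Cinv_l|].
      replace (fun t => / (b O * K) * mulT_raw p r F t)%C with
        (fun t => / b O * translate_prod (p ^ r) (fn F) t)%C.
      - now apply q_expansion_scal.
      - apply functional_extensionality; intros t; rewrite ER; field; auto. }
    (* The description in [normalizer] has its property once unique existence is known: [L] gives
       the witness, [leading_coef_scal_unique] the uniqueness. *)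
    apply (iota_correct (V := C_CompleteNormedModule)
      (fun eps : C => leading_coef (fun t => (eps * mulT_raw p r F t)%C) (RtoC 1))).
    exists (/ (b O * K))%C; split; [exact L|].
    intros eps; now apply leading_coef_scal_unique.
Qed.

Theorem theorem3p6 :
  forall (N p r s : nat),
    (1 <= N)%nat -> prime (Z.of_nat p) -> Nat.divide p N ->
    (1 <= r)%nat -> (1 <= s)%nat ->
    forall F : wfun, in_M N F ->
      wfun_eq (mulT p s (mulT p r F)) (mulT p r (mulT p s F)) /\
      wfun_eq (mulT p r (mulT p s F)) (mulT p (r + s) F).
Proof.
  intros N p r s _ Hp _ _ _ F [_ [_ [_ [kappa [a [a0 Ha]]]]]].
  apply prime_ge_2 in Hp.
  assert (H0 : (0 < p)%nat) by lia; clear Hp.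
  assert (Hpow : forall n, (0 < p ^ n)%nat)
    by (intros n; apply Nat.neq_0_lt_0, Nat.pow_nonzero; lia).
  assert (HF : leading_coef (fn F) (RtoC 1)).
  { split; [intros E; apply RtoC_inj in E; lra|].
    exists kappa, (fun n => RtoC (IZR (a n))); rewrite a0; auto. }
  (* The composition law holds as an equality of bundled functions for all exponents, so both claims
     reduce to commutativity of addition. *)
  assert (twice : forall u v, mulT p v (mulT p u F) = mulT p (u + v) F).
  { intros u v.
    destruct (mulT_spec p u F H0 HF) as [[c Hc] Lu].
    destruct (mulT_spec p v _ H0 Lu) as [[d Hd] Lv].
    destruct (mulT_spec p (u + v) F H0 HF) as [[e He] Luv].
    set (G := translate_prod (p ^ (u + v)) (fn F)) in *.
    (* The scalar [c] of the inner operator enters each of the [p^v] factors of the outer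
       product. *)
    assert (Hd' : forall t, fn (mulT p v (mulT p u F)) t = (d * c ^ (p ^ v) * G t)%C).
    { intros t; rewrite Hd, (functional_extensionality _ _ Hc), translate_prod_scal.
      unfold G; rewrite translate_prod_comp, <- Nat.pow_add_r by apply Hpow; ring. }
    rewrite (functional_extensionality _ _ Hd') in Lv.
    rewrite (functional_extensionality _ _ He) in Luv.
    assert (Ew : wt (mulT p v (mulT p u F)) = wt (mulT p (u + v) F)).
    { simpl; now rewrite <- Z.mul_assoc, <- Nat2Z.inj_mul, <- Nat.pow_add_r. }
    assert (Ef : fn (mulT p v (mulT p u F)) = fn (mulT p (u + v) F)).
    { apply functional_extensionality; intros t.
      (* Both [d * c^(p^v)] and [e] give the same function [G] leading coefficient 1, hence they
         coincide. *)
      rewrite Hd', He; f_equal; exact (leading_coef_scal_unique _ _ _ Lv Luv). }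
    destruct (mulT p v (mulT p u F)), (mulT p (u + v) F); simpl in Ew, Ef; now subst. }
  rewrite !twice, (Nat.add_comm s r).
  assert (refl : forall G, wfun_eq G G).
  { intros G; split; [reflexivity|]; intros z _; now apply (filter_forall (F := locally' z)). }
  split; apply refl.
Qed.
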